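(* Let $\lambda$ be a nonzero real number and let $\phi_{n,\lambda}(x)$ ($n\ge 0$) be the degenerate Bell polynomials. Then for every integer $n\ge 0$, $$\sum_{k=0}^{n}\binom{n}{k}(\lambda)_{n-k,\lambda}\,\phi_{k+1,\lambda}(x)=x\Big(\phi_{n,\lambda}^{\prime}(x)+\phi_{n,\lambda}(x)\Big),$$ where $\phi_{n,\lambda}^{\prime}(x)=\frac{d}{dx}\phi_{n,\lambda}(x)$.
   Context: For a nonzero real number $\lambda$: generalized falling factorials $(x)_{0,\lambda}=1$, $(x)_{n,\lambda}=x(x-\lambda)\cdots(x-(n-1)\lambda)$ for $n\ge 1$. With $(x)_0=1$ and $(x)_n=x(x-1)\cdots(x-n+1)$ for $n\ge 1$, the degenerate Stirling numbers of the second kind ${n \brace k}_{\lambda}$ ($0\le k\le n$) are defined by the polynomial identity $(x)_{n,\lambda}=\sum_{k=0}^{n}{n \brace k}_{\lambda}(x)_{k}$, $n\ge 0$. The degenerate Bell polynomials are $\phi_{n,\lambda}(x)=\sum_{k=0}^{n}{n \brace k}_{\lambda}x^{k}$. *)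

(* Defs.v *)
From HB Require Import structures.
From mathcomp Require Import all_boot all_order all_algebra.
From mathcomp Require Import boolp reals.

Set Implicit Arguments.
Unset Strict Implicit.
Unset Printing Implicit Defensive.

Import Order.TTheory GRing.Theory Num.Theory.

Local Open Scope ring_scope.

(* The falling factorials are defined over an arbitrary commutative ring so   *)
(* that they can be taken both at a scalar and at the indeterminate 'X.       *)
Definition dfalling (A : comNzRingType) (lam x : A) (n : nat) : A :=
  \prod_(i < n) (x - i%:R * lam).

Definition falling (A : comNzRingType) (x : A) (n : nat) : A :=
  \prod_(i < n) (x - i%:R).

Definition is_dstirling2 (R : realType) (lam : R) (S : nat -> nat -> R) : Prop :=
  forall n : nat,
    dfalling lam%:P 'X n = \sum_(k < n.+1) S n k *: falling ('X : {poly R}) k.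

Lemma falling_monic_size (R : realType) (k : nat) :
  falling ('X : {poly R}) k \is monic /\ size (falling ('X : {poly R}) k) = k.+1.
Proof.
have -> : falling ('X : {poly R}) k = \prod_(i < k) ('X - (i%:R)%:P).
  by apply: eq_bigr => i _; rewrite rmorph_nat.
by rewrite monic_prod_XsubC size_prod_XsubC /index_enum -enumT size_enum_ord.
Qed.

Lemma falling_lin_indep (R : realType) (n : nat) (a : nat -> R) :
  \sum_(k < n) a k *: falling ('X : {poly R}) k = 0 ->
  forall k, (k < n)%N -> a k = 0.
Proof.
elim: n => [|n IHn] // h0.
have an0 : a n = 0.
  have [/monicP lcn szn] := falling_monic_size R n.
  move/(congr1 (fun p : {poly R} => p`_n)): h0.
  rewrite big_ord_recr /= coefD coef0 coefZ coef_sum big1 ?add0r.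
    by move: lcn; rewrite /lead_coef szn /= => ->; rewrite mulr1.
  move=> i _; rewrite coefZ nth_default ?mulr0 //.
  by have [_ ->] := falling_monic_size R i; apply: ltn_ord.
move: h0; rewrite big_ord_recr /= an0 scale0r addr0 => h0 k.
by rewrite ltnS leq_eqVlt => /predU1P[-> //|]; apply: IHn.
Qed.

Lemma is_dstirling2_unique (R : realType) (lam : R) (S T : nat -> nat -> R) :
  is_dstirling2 lam S -> is_dstirling2 lam T ->
  forall n k, (k <= n)%N -> S n k = T n k.
Proof.
move=> hS hT n k lekn; apply/eqP; rewrite -subr_eq0; apply/eqP.
apply: (@falling_lin_indep R n.+1 (fun k => S n k - T n k)) => //.
under eq_bigr do rewrite scalerBl.
by rewrite sumrB -hS -hT subrr.
Qed.

Lemma dstirling2_exists (R : realType) (lam : R) :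
  exists S : nat -> nat -> R, is_dstirling2 lam S.
Proof.
suff /choice[S hS] : forall n, exists s : nat -> R,
    dfalling lam%:P 'X n = \sum_(k < n.+1) s k *: falling ('X : {poly R}) k.
  by exists S.
elim=> [|n [s hs]].
  by exists (fun=> 1); rewrite big_ord1 /dfalling /falling !big_ord0 scale1r.
exists (fun k => (if k is j.+1 then s j else 0) +
                 (if (k <= n)%N then (k%:R - n%:R * lam) * s k else 0)).
rewrite {1}/dfalling big_ord_recr /= -/(dfalling _ _ _) hs mulr_suml.
under [RHS]eq_bigr do rewrite scalerDl.
rewrite big_split /= [X in _ = X + _]big_ord_recl /= scale0r add0r.
rewrite [X in _ = _ + X]big_ord_recr /= ltnn scale0r addr0 -big_split /=.
apply: eq_bigr => i _; rewrite leq_ord /bump /= add1n.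
rewrite {2}/falling big_ord_recr /= -/(falling _ _).
rewrite -scalerAl [_ * s i]mulrC -scalerA -scalerDr; congr (_ *: _).
rewrite -mul_polyC [polyC _ * _]mulrC -mulrDr rmorphB rmorphM !rmorph_nat /=.
by rewrite addrA subrK.
Qed.

(* Only the values with k <= n are determined by the defining identity.       *)
Definition dstirling2 (R : realType) (lam : R) : nat -> nat -> R :=
  sval (cid (dstirling2_exists lam)).

Lemma dstirling2P (R : realType) (lam : R) : is_dstirling2 lam (dstirling2 lam).
Proof. exact: svalP (cid (dstirling2_exists lam)). Qed.

Definition dbell (R : realType) (lam : R) (n : nat) : {poly R} :=
  \sum_(k < n.+1) dstirling2 lam n k *: 'X^k.

(* Main.v *)
Require Import Defs.
From HB Require Import structures.
From mathcomp Require Import all_boot all_order all_algebra.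
From mathcomp Require Import boolp reals.

Import Order.TTheory GRing.Theory Num.Theory.

Local Open Scope ring_scope.

(** Since [(lam)_{m, lam}] contains the factor [lam - lam] as soon as [m >= 2],
    only the terms [k = n] and [k = n - 1] of the sum survive, and the identity
    amounts to the recurrence
      [phi_{n+1} + n lam phi_n = x (phi_n' + phi_n)].
    The recurrence is proved umbrally. Let [U] be the linear operator on
    polynomials sending [x^k] to the falling factorial [(x)_k]. By definition
    [U phi_n = (x)_{n, lam}], and [x (x)_k = (x)_{k+1} + k (x)_k] says that [U]
    turns the operator [p |-> x (p' + p)] into multiplication by [x]
    ([umbral_mulX]). Hence both sides of the recurrence have the same image,
    because [(x)_{n+1, lam} + n lam (x)_{n, lam} = x (x)_{n, lam}], and [U] is
    injective as the falling factorials are linearly independent. *)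

(** The umbral operator: the linear map sending ['X^k] to [(X)_k]. *)
Definition umbral (R : realType) (p : {poly R}) : {poly R} :=
  \sum_(k < size p) p`_k *: falling 'X k.

Lemma umbral_widen (R : realType) (p : {poly R}) (N : nat) :
  (size p <= N)%N -> umbral R p = \sum_(k < N) p`_k *: falling 'X k.
Proof.
move=> leN; rewrite /umbral.
rewrite (big_ord_widen N (fun k => p`_k *: falling 'X k) leN) big_mkcond /=.
apply: eq_bigr => k _; case: ltnP => // le_p_k.
by rewrite nth_default ?scale0r.
Qed.

Lemma umbral_is_linear (R : realType) : linear (umbral R).
Proof.
move=> a p q; pose N := maxn (size p) (size q).
have leN : (size (a *: p + q)%R <= N)%N.
  rewrite (leq_trans (size_polyD _ _)) // geq_max leq_maxr andbT.
  by rewrite (leq_trans (size_scale_leq _ _)) // leq_maxl.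
rewrite (umbral_widen _ _ N leN) (umbral_widen _ p N (leq_maxl _ _)).
rewrite (umbral_widen _ q N (leq_maxr _ _)) scaler_sumr -big_split /=.
by apply: eq_bigr => k _; rewrite coefD coefZ scalerDl scalerA.
Qed.

HB.instance Definition _ (R : realType) :=
  GRing.isLinear.Build R {poly R} {poly R} *:%R (umbral R)
    (umbral_is_linear R).

Lemma umbralXn (R : realType) (k : nat) : umbral R 'X^k = falling 'X k.
Proof.
rewrite /umbral size_polyXn big_ord_recr /= coefXn eqxx scale1r big1 ?add0r //.
by move=> i _; rewrite coefXn ltn_eqF // scale0r.
Qed.

Lemma umbral_inj (R : realType) : injective (umbral R).
Proof.
move=> p q eq_pq; apply/eqP; rewrite -subr_eq0; apply/eqP/polyP => k.
rewrite coef0; have [ltk|/leq_sizeP-> //] := ltnP k (size (p - q)%R).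
apply: (@falling_lin_indep R _ (fun k => (p - q)`_k) _ _ ltk).
by rewrite -/(umbral R (p - q)) raddfB /= eq_pq subrr.
Qed.

Lemma umbral_mulX (R : realType) (p : {poly R}) :
  umbral R ('X * (p^`() + p)) = 'X * umbral R p.
Proof.
rewrite -[p]coefK poly_def !raddf_sum -big_split !mulr_sumr raddf_sum /=.
apply: eq_bigr => i _; rewrite derivZ -scalerDr -scalerAr !linearZ /=.
rewrite -scalerAr; congr (_ *: _).
have -> : 'X * (('X^i)^`() + 'X^i) = 'X^i *+ i + 'X^(i.+1) :> {poly R}.
  rewrite derivXn mulrDr -exprS; congr (_ + _).
  by case: (nat_of_ord i) => [|j]; rewrite ?mulr0n ?mulr0 // mulrnAr -exprS.
rewrite raddfD raddfMn /= !umbralXn /falling big_ord_recr /=.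
by rewrite mulrBr addrC mulr_natr subrK mulrC.
Qed.

Lemma umbral_dbell (R : realType) (lam : R) (n : nat) :
  umbral R (dbell lam n) = dfalling lam%:P 'X n.
Proof.
rewrite (dstirling2P lam n) /dbell raddf_sum.
by apply: eq_bigr => k _ /=; rewrite linearZ /= umbralXn.
Qed.

Lemma dbellS (R : realType) (lam : R) (n : nat) :
  dbell lam n.+1 + (n%:R * lam) *: dbell lam n
  = 'X * ((dbell lam n)^`() + dbell lam n).
Proof.
apply: umbral_inj; rewrite umbral_mulX raddfD /= linearZ /= !umbral_dbell.
rewrite /dfalling big_ord_recr /= -mul_polyC polyCM polyC_natr.
by rewrite [_ * ('X - _)]mulrC -mulrDl subrK.
Qed.

Lemma dfalling_self_eq0 (A : comNzRingType) (lam : A) (m : nat) :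
  dfalling lam lam m.+2 = 0.
Proof.
by rewrite /dfalling 2!big_ord_recl /= mul1r subrr !mul0r mulr0.
Qed.

Theorem theorem2p8 (R : realType) (lam : R) (hlam : lam != 0) (n : nat) :
  \sum_(k < n.+1)
     ('C(n, k)%:R * dfalling lam lam (n - k)) *: dbell lam k.+1
  = 'X * ((dbell lam n)^`() + dbell lam n).
Proof.
rewrite -dbellS big_ord_recr /= binn subnn {2}/dfalling big_ord0 mulr1 scale1r.
rewrite addrC; congr (_ + _).
case: n => [|n]; first by rewrite big_ord0 mul0r scale0r.
rewrite big_ord_recr /= big1 ?add0r => [|i _].
  by rewrite subSnn binSn /dfalling big_ord1 mul0r subr0.
have -> : (n.+1 - i = (n - i.+1).+2)%N by rewrite -subSn // subSS subSn // ltnW.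
by rewrite dfalling_self_eq0 mulr0 scale0r.
Qed.
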